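(* Let $X$ be a set of alternatives, let $T=\{\langle \mathsf{C}_i,n_i,m_i\rangle\}_{i\in I}$ be a representation such that $TX$ admits a $T$-representation map, and let $\mathcal V\subseteq TX$ be expressive. If a decision procedure $P\colon TX\to X$ is intensional (INT) and $\mathcal V$-rationalizable, then $$\forall\, \mathbf a\in TX/\!\simeq\ \ \exists\, i\in\mathbb N\ \ \forall A\subseteq X\ \ \exists\, v\in X\ \ \forall a\in\mathcal V\cap\mathbf a\ \ \bigl([\![a]\!]=A\ \Rightarrow\ a[i]=v\bigr),$$ where $A$ ranges over non-empty finite subsets of $X$.
   Context: $X$ is a set of alternatives, and $2^X$ denotes the set of non-empty finite subsets of $X$ (the ''decision problems''). Representations. $T=\{\langle \mathsf{C}_i,n_i,m_i\rangle\}_{i\in I}$ is a finite set of triples, where the $\mathsf{C}_i$ are pairwise distinct names (constructors) and $n_i,m_i\ge 0$ are natural numbers; at least one constructor has $n_i>0$ and $m_i=0$. $TX$ is the set of (finite) terms obtained by repeated application of the rule: if $x_1,\dots,x_{n_i}\in X$ and $a_1,\dots,a_{m_i}\in TX$, then $\mathsf{C}_i\,x_1\ldots x_{n_i}\,a_1\ldots a_{m_i}\in TX$, for each $i\in I$. Repetitions among the $x_j$ or the $a_j$ are allowed. For $a=\mathsf{C}_i\,x_1\ldots x_{n_i}\,a_1\ldots a_{m_i}$, put $\mathrm{iv}(a)=\{x_1,\dots,x_{n_i}\}$ and $\mathrm{sp}(a)=\{a_1,\dots,a_{m_i}\}$. The extension map is defined inductively by $[\![a]\!]=\mathrm{iv}(a)\cup\bigcup_{b\in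 \mathrm{sp}(a)}[\![b]\!]$. A $T$-representation map is a map $r\colon 2^X\to TX$ with $[\![r(A)]\!]=A$ for all $A\in 2^X$. A subset $\mathcal V\subseteq TX$ is expressive if for every $A\in 2^X$ there exists $a\in\mathcal V$ with $[\![a]\!]=A$. Indices. The index representation $\iota(a)\in T\mathbb N$ of $a\in TX$ is obtained by traversing $a$ depth-first and replacing the successive occurrences of elements of $X$ by $1,2,3,\dots$; e.g. $\mathsf C\,x\,(\mathsf C\,y\,(\mathsf S\,x))$ has index representation $\mathsf C\,1\,(\mathsf C\,2\,(\mathsf S\,3))$. For an index $i$ occurring in $\iota(a)$, $a[i]\in X$ denotes the value of $a$ at the position with index $i$; an equation $a[i]=v$ includes the assertion that $i$ occurs as an index in $a$. Write $a\simeq b$ iff $\iota(a)=\iota(b)$; this is an equivalence relation on $TX$, and $TX/\!\simeq$ is the set of its equivalence classes. Decision procedures. A decision procedure is a function $P\colon TX\to X$ with $P(a)\in[\![a]\!]$ for all $a\in TX$. $P$ is intensional (INT) if for every $\mathbf a\in TX/\!\simeq$ there exists $i\in\mathbb N$ such that $P(a)=a[i]$ for all $a\in\mathbf a$. Rationalizability. A strict preference relation $(X,\succ)$ is a complete, transitive, anti-symmetric relation on $X$; for $A\in 2^X$, $\max_\succ A$ is the unique $x\in A$ with $x\succ y$ for all $y\in A$, $y\ne x$. $P$ is $\mathcal V$-rationalizable if there is a strict preference relation $(X,\succ)$ such that $P(a)=\max_\succ[\![a]\!]$ for all $a\in\mathcal V$. *)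

(* Defs.v *)
From HB Require Import structures.
From mathcomp Require Import all_boot.
From mathcomp Require Import boolp classical_sets functions cardinality.

Set Implicit Arguments.
Unset Strict Implicit.
Unset Printing Implicit Defensive.

Local Open Scope classical_set_scope.

Definition decision_problem (X : Type) : Type :=
  {A : set X | finite_set A /\ A !=set0}.

(* A constructor c takes [nvals c] elements of X followed by [nsubs c] terms.
   Indexing by the names themselves makes them pairwise distinct. *)
Record representation : Type := Representation {
  constructor :> finType;
  nvals : constructor -> nat;
  nsubs : constructor -> nat;
  has_base_constructor : exists c, (0 < nvals c)%N /\ nsubs c = 0%N
}.

(* [term T X] is TX; the finite functions [_ ^ _] make the nesting positive. *)
Inductive term (T : representation) (X : Type) : Type :=
  Term (c : T) of (nvals c).-tuple X & (term T X ^ nsubs c)%type.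

Definition iv (T : representation) (X : Type) (a : term T X) : set X :=
  let: Term c xs _ := a in range (tnth xs).

Definition sp (T : representation) (X : Type) (a : term T X) :
    set (term T X) :=
  let: Term c _ ts := a in range ts.

Fixpoint ext (T : representation) (X : Type) (a : term T X) : set X :=
  let: Term c xs ts := a in
  range (tnth xs) `|` \bigcup_j ext (ts j).

Lemma extE (T : representation) (X : Type) (a : term T X) :
  ext a = iv a `|` \bigcup_(b in sp a) ext b.
Proof. by case: a => c xs ts /=; rewrite bigcup_image. Qed.

Definition representation_map (T : representation) (X : Type)
    (r : decision_problem X -> term T X) : Prop :=
  forall A, ext (r A) = sval A.

Definition expressive (T : representation) (X : Type)
    (V : set (term T X)) : Prop :=
  forall A : decision_problem X, exists2 a, V a & ext a = sval A.

(* The occurrences of elements of X in a, in depth-first order. *)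
Fixpoint occurrences (T : representation) (X : Type) (a : term T X) : seq X :=
  let: Term c xs ts := a in
  xs ++ flatten (codom (fun j => occurrences (ts j))).

(* Relabels the occurrences by k, k + 1, ...: before the j-th subterm is
   reached, the own values and the subterms to its left have been numbered. *)
Fixpoint index_from (T : representation) (X : Type) (k : nat) (a : term T X) :
    term T nat :=
  let: Term c xs ts := a in
  Term [tuple k + j | j < nvals c]
    [ffun j : 'I_(nsubs c) =>
      index_from
        (k + nvals c
           + \sum_(l < nsubs c | l < j) size (occurrences (ts l)))%N
        (ts j)].

Definition index_rep (T : representation) (X : Type) (a : term T X) :
    term T nat :=
  index_from 1 a.

Lemma flatten_iota (m s : nat) (f : 'I_m -> nat) :
  flatten [seq iota (s + \sum_(l < m | l < j) f l)%N (f j)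
             | j : 'I_m <- enum 'I_m]
  = iota s (\sum_(l < m) f l)%N.
Proof.
elim: m f => [|m IH] f; first by rewrite enum_ord0 big_ord0.
rewrite enum_ordSr map_rcons flatten_rcons big_ord_recr /= iotaD -IH.
congr cat.
  rewrite -map_comp; congr flatten; apply: eq_map => j /=.
  congr (iota (s + _) _); rewrite big_mkcond big_ord_recr /=.
  by rewrite [(m < j)%N]ltnNge (ltnW (ltn_ord j)) addn0 -big_mkcond.
congr (iota (s + _) _); rewrite big_mkcond big_ord_recr /= ltnn addn0.
by apply: eq_bigr => l _; rewrite ltn_ord.
Qed.

Lemma occurrences_index_from (T : representation) (X : Type) :
  forall (a : term T X) (k : nat),
  occurrences (index_from k a) = iota k (size (occurrences a)).
Proof.
fix IH 1 => -[c xs ts] k /=.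
rewrite size_cat size_tuple iotaD; congr cat.
  rewrite enumT -enumT -[k in RHS]addn0 iotaDl -val_enum_ord -map_comp.
  exact: eq_map.
have -> : size (flatten (codom (fun j => occurrences (ts j))))
          = (\sum_(j < nsubs c) size (occurrences (ts j)))%N.
  by rewrite size_flatten sumnE !big_map -enumT big_enum.
rewrite -flatten_iota.
by congr flatten; apply: eq_map => j; rewrite ffunE IH.
Qed.

Lemma occurrences_index_rep (T : representation) (X : Type) (a : term T X) :
  occurrences (index_rep a) = iota 1 (size (occurrences a)).
Proof. exact: occurrences_index_from. Qed.

(* [value_at a i v] is the equation a[i] = v: some position p carries the
   index i in the index representation of a, and carries v in a. In
   particular it fails when i does not occur as an index in a. *)
Definition value_at (T : representation) (X : Type) (a : term T X) (i : nat)
    (v : X) : Prop :=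
  exists p, onth (occurrences (index_rep a)) p = Some i /\
            onth (occurrences a) p = Some v.

Definition same_index (T : representation) (X : Type) (a b : term T X) : Prop :=
  index_rep a = index_rep b.

Definition index_classes (T : representation) (X : Type) :
    set (set (term T X)) :=
  [set [set b | same_index a b] | a in setT].

Definition decision_procedure (T : representation) (X : Type)
    (P : term T X -> X) : Prop :=
  forall a, ext a (P a).

Definition intensional (T : representation) (X : Type)
    (P : term T X -> X) : Prop :=
  forall C, index_classes C ->
    exists i : nat, forall a, C a -> value_at a i (P a).

(* Since the relation is strict, completeness concerns distinct alternatives;
   nothing is imposed on the diagonal, which [is_max] does not inspect. *)
Definition strict_preference (X : Type) (R : X -> X -> Prop) : Prop :=
  [/\ forall x y, x <> y -> R x y \/ R y x,
      forall x y z, R x y -> R y z -> R x z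
    & forall x y, R x y -> R y x -> x = y].

Definition is_max (X : Type) (R : X -> X -> Prop) (A : set X) (x : X) : Prop :=
  A x /\ forall y, A y -> y <> x -> R x y.

Lemma is_max_unique (X : Type) (R : X -> X -> Prop) (A : set X) (x y : X) :
  strict_preference R -> is_max R A x -> is_max R A y -> x = y.
Proof.
move=> [_ _ antiR] [Ax maxx] [Ay maxy].
have [//|nxy] := pselect (x = y).
by apply: antiR; [apply: maxx => // yx; exact: nxy | exact: maxy].
Qed.

Definition rationalizable (T : representation) (X : Type)
    (V : set (term T X)) (P : term T X -> X) : Prop :=
  exists2 R : X -> X -> Prop, strict_preference R &
    forall a, V a -> is_max R (ext a) (P a).

(* Main.v *)
Require Import Defs.
From mathcomp Require Import all_boot.
From mathcomp Require Import boolp classical_sets functions cardinality.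

Local Open Scope classical_set_scope.

(** Rationalizability makes [P] constant on the terms of [V] with extension [A]: its value is the
    maximum of [A]. So the index that INT gives for [C] works for every [A], with this maximum as
    [v]. *)

Theorem theorem6p9 (X : Type) (T : representation)
    (hr : exists r : decision_problem X -> term T X, representation_map r)
    (V : set (term T X)) (hV : expressive V)
    (P : term T X -> X) (hP : decision_procedure P)
    (hint : intensional P) (hrat : rationalizable V P) :
  forall C : set (term T X), index_classes C ->
  exists i : nat,
  forall A : decision_problem X,
  exists v : X,
  forall a : term T X, (V `&` C) a -> ext a = sval A -> value_at a i v.
Proof.
have [R prefR maxP] := hrat.
move=> C /hint[i valP]; exists i => A.
(* Expressiveness gives a term [a0], possibly outside [C], whose choice names the maximum of [A]
   before [a] is given, even if no term of [V] in [C] has extension [A]. *)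
have [a0 Va0 ext_a0] := hV A; exists (P a0) => a [Va Ca] ext_a.
suff -> : P a0 = P a by exact: valP.
apply: (is_max_unique prefR (maxP _ Va0)).
by rewrite ext_a0 -ext_a; exact: maxP.
Qed.
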